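(* Let $\Gamma$ be a discrete subring of $\mathbb{C}$ (containing $1$) and $K$ its quotient field. Let $z$ be a quadratic surd over $K$ and let $\{z_n\}_{n=0}^\infty$ be a sequence in $\mathbb{C}^*$ with $z_0=z$, $|z_n|\ge1$ for $n\ge1$, $z_{n+1}\neq z_n^{-1}$, such that $a_n=z_n-z_{n+1}^{-1}\in\Gamma$ for all $n\ge 0$. Let $\{p_n\},\{q_n\}$ be the $\mathcal{Q}$-pair of $\{a_n\}$. Suppose that (i) there exists $\alpha>0$ with $|z_n|>1+\alpha$ for all $n\geq 1$, and (ii) $|q_n|\to\infty$ as $n\to\infty$. Then the set $\{z_n\mid n\geq 0\}$ is finite. Consequently, if moreover $\{z_n\}$ arises from an algorithm, i.e. there is a map $f:\mathbb{C}\to\Gamma$ with $|\zeta-f(\zeta)|\le1$ for all $\zeta$ such that $z_{n+1}=(z_n-f(z_n))^{-1}$ for all $n\geq 0$, then $\{a_n\}$ is eventually periodic.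
   Context: A number is a quadratic surd over $K$ if it is not in $K$ and is a root of a quadratic polynomial over $K$. For a sequence $\{a_n\}_{n\ge0}$, its $\mathcal{Q}$-pair is defined by $p_{-1}=1$, $p_0=a_0$, $p_{n+1}=a_{n+1}p_n+p_{n-1}$, $q_{-1}=0$, $q_0=1$, $q_{n+1}=a_{n+1}q_n+q_{n-1}$ ($n\ge0$). *)

(* Defs.v *)
From HB Require Import structures.
From mathcomp Require Import all_boot all_order all_algebra.
From mathcomp Require Import complex.
From mathcomp Require Import all_classical all_reals all_analysis.
Set Implicit Arguments.
Unset Strict Implicit.
Unset Printing Implicit Defensive.
Import Order.TTheory GRing.Theory Num.Theory.
Import numFieldNormedType.Exports.

Local Open Scope classical_set_scope.
Local Open Scope ring_scope.
Local Open Scope complex_scope.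

(* The subspace topology on A is discrete; R[i]^o is R[i] with the topology of
   its norm. *)
Definition discrete_subset (R : realType) (A : {pred R[i]}) : Prop :=
  [set` A] `<=` isolated ([set` A] : set R[i]^o).

Definition quotient_field (F : fieldType) (S : {pred F}) : {pred F} :=
  [pred x | `[< exists a b, [/\ a \in S, b \in S, b != 0 & x = a / b] >]].

Definition quadratic_surd (F : fieldType) (K : {pred F}) (x : F) : Prop :=
  x \notin K /\
  exists P : {poly F}, [/\ P \is a polyOver K, size P = 3%N & root P x].

(* Indices are shifted by one: Qpair_rec u v a m is the term of index m - 1 of
   the solution of x_{n+1} = a_{n+1} x_n + x_{n-1} with x_{-1} = u, x_0 = v. *)
Fixpoint Qpair_rec (F : fieldType) (u v : F) (a : nat -> F) (m : nat) : F :=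
  match m with
  | 0 => u
  | 1 => v
  | (n.+1 as n1).+1 => a n1 * Qpair_rec u v a n1 + Qpair_rec u v a n
  end.

Definition Qpair_p (F : fieldType) (a : nat -> F) (n : nat) : F :=
  Qpair_rec 1 (a 0%N) a n.+1.

Definition Qpair_q (F : fieldType) (a : nat -> F) (n : nat) : F :=
  Qpair_rec 0 1 a n.+1.

Definition eventually_periodic (T : Type) (a : nat -> T) : Prop :=
  exists N k : nat, (0 < k)%N /\ forall n, (N <= n)%N -> a (n + k)%N = a n.

(* Main.v *)
(* If z_n is a root of A X^2 + B X + C, then substituting z_n = a_n + 1/z_{n+1}
   shows that z_{n+1} is a root of A' X^2 + B' X + C' with A' = A a^2 + B a + C,
   B' = 2 A a + B and C' = A.  Starting from a quadratic equation of z with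
   coefficients in Gamma, all these coefficients stay in Gamma.  The value
   D_n = 2 A_n z_n + B_n of the derivative at the root satisfies
   D_{n+1} = - D_n, and A_{n+1} = - D_n / z_{n+1} + A_n / z_{n+1}^2; as
   |z_{n+1}| > 1 + alpha, this contraction bounds the A_n, hence the
   C_{n+1} = A_n, and the B_n by B_n^2 = D_n^2 + 4 A_n C_n.  Since a discrete
   subring has finitely many elements of bounded norm, and
   z_n = (D_n - B_n) / (2 A_n) with D_n = +- D_0, the z_n are finitely many. *)

Require Import Defs.
From HB Require Import structures.
From mathcomp Require Import all_boot all_order all_algebra.
From mathcomp Require Import complex.
From mathcomp Require Import all_classical all_reals all_analysis.
From mathcomp Require Import ring lra.
Set Implicit Arguments.
Unset Strict Implicit.
Unset Printing Implicit Defensive.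
Import Order.TTheory GRing.Theory Num.Theory.
Import numFieldNormedType.Exports.

Local Open Scope classical_set_scope.
Local Open Scope ring_scope.
Local Open Scope complex_scope.

(** * Transformation of a quadratic equation under one step of the expansion *)

Section QuadraticEquations.
Variable F : fieldType.

Definition surd_coefs_step (t : F * F * F) (a : F) : F * F * F :=
  let: (A, B, C) := t in (A * a ^+ 2 + B * a + C, 2 * A * a + B, A).

Definition surd_coefs (t : F * F * F) (a : nat -> F) (n : nat) : F * F * F :=
  iteri n (fun k u => surd_coefs_step u (a k)) t.

Definition surd_eval (t : F * F * F) (x : F) : F :=
  t.1.1 * x ^+ 2 + t.1.2 * x + t.2.

Definition surd_deriv (t : F * F * F) (x : F) : F := 2 * t.1.1 * x + t.1.2.

Lemma surd_step_root (t : F * F * F) (x w : F) : w != 0 ->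
  surd_eval t x = 0 -> surd_eval (surd_coefs_step t (x - w^-1)) w = 0.
Proof.
case: t => [[A B] C] w0; rewrite /surd_eval /= => E.
(* Solving the root equation for [C] leaves a rational identity in [A], [B], [x] and [w]. *)
have -> : C = - (A * x ^+ 2 + B * x) by rewrite -[LHS]subr0 -E; ring.
by field.
Qed.

Lemma surd_step_deriv (t : F * F * F) (x w : F) : w != 0 ->
  surd_eval t x = 0 ->
  surd_deriv (surd_coefs_step t (x - w^-1)) w = - surd_deriv t x.
Proof.
case: t => [[A B] C] w0; rewrite /surd_eval /surd_deriv /= => E.
have -> : C = - (A * x ^+ 2 + B * x) by rewrite -[LHS]subr0 -E; ring.
by field.
Qed.

(** Taylor expansion of the quadratic at its root [x] with increment [- w^-1], multiplied by [w];
    taking norms gives the recursive inequality behind the bound on the leading coefficients. *)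
Lemma surd_step_lead (t : F * F * F) (x w : F) : w != 0 ->
  surd_eval t x = 0 ->
  (surd_coefs_step t (x - w^-1)).1.1 * w = - surd_deriv t x + t.1.1 / w.
Proof.
case: t => [[A B] C] w0; rewrite /surd_eval /surd_deriv /= => E.
have -> : C = - (A * x ^+ 2 + B * x) by rewrite -[LHS]subr0 -E; ring.
by field.
Qed.

Lemma surd_discr (t : F * F * F) (x : F) : surd_eval t x = 0 ->
  t.1.2 ^+ 2 = surd_deriv t x ^+ 2 + 4 * t.1.1 * t.2.
Proof.
case: t => [[A B] C]; rewrite /surd_eval /surd_deriv /= => E.
have -> : C = - (A * x ^+ 2 + B * x) by rewrite -[LHS]subr0 -E; ring.
by ring.
Qed.

Lemma surd_coefsS t a n :
  surd_coefs t a n.+1 = surd_coefs_step (surd_coefs t a n) (a n).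
Proof. by []. Qed.

(** * Coefficients in a subring and its quotient field *)

Section Subring.
Variables (S : {pred F}) (S_ring : subring_closed S).

Definition coefs_in (t : F * F * F) : Prop :=
  [/\ t.1.1 \in S, t.1.2 \in S & t.2 \in S].

Lemma subring_sub x y : x \in S -> y \in S -> x - y \in S.
Proof. by case: S_ring => _ + _; apply. Qed.

Lemma subring_mul x y : x \in S -> y \in S -> x * y \in S.
Proof. by case: S_ring => _ _; apply. Qed.

Lemma subring1 : 1 \in S. Proof. by case: S_ring. Qed.

Lemma subring0 : 0 \in S.
Proof. by rewrite -(subrr 1) subring_sub ?subring1. Qed.

Lemma subring_opp x : x \in S -> - x \in S.
Proof. by move=> xS; rewrite -sub0r subring_sub ?subring0. Qed.

Lemma subring_add x y : x \in S -> y \in S -> x + y \in S.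
Proof. by move=> xS yS; rewrite -[y]opprK subring_sub ?subring_opp. Qed.

Lemma surd_step_in t a : a \in S -> coefs_in t -> coefs_in (surd_coefs_step t a).
Proof.
case: t => [[A B] C] aS [/= AS BS CS].
by split; rewrite /= ?expr2 ?(subring_add, subring_mul, subring1).
Qed.

Lemma surd_coefs_in t a n : (forall k, a k \in S) -> coefs_in t ->
  coefs_in (surd_coefs t a n).
Proof.
by move=> aS tS; elim: n => // n IH; rewrite surd_coefsS; apply: surd_step_in.
Qed.

Lemma mem_quotient_field (c d : F) : c \in S -> d \in S -> d != 0 ->
  c / d \in quotient_field S.
Proof. by move=> cS dS d0; rewrite inE; exists c, d. Qed.

(** Used in contrapositive form: no [z_ n] can enter the quotient field, since [z_ n] is [a n] plus
    the inverse of its successor. *)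
Lemma quotient_field_addV (a x : F) : a \in S -> x != 0 ->
  x \in quotient_field S -> a + x^-1 \in quotient_field S.
Proof.
move=> aS x0; rewrite [in X in X -> _]inE.
move=> [c [d [cS dS d0 xE]]].
have c0 : c != 0 by apply: contraNneq x0 => c0; rewrite xE c0 mul0r.
have -> : a + x^-1 = (a * c + d) / c by rewrite xE; field; rewrite c0.
by rewrite mem_quotient_field // subring_add // subring_mul.
Qed.

Lemma quadratic_surd_coefs (z : F) : quadratic_surd (quotient_field S) z ->
  exists t, [/\ coefs_in t, t.1.1 != 0 & surd_eval t z = 0].
Proof.
move=> [zK [P [PK sP /rootP]]].
rewrite horner_coef sP !big_ord_recr big_ord0 /= add0r expr0 mulr1 expr1 => Pz.
have P2 : P`_2 != 0.
  by rewrite -[2%N]/(3.-1)%N -sP -lead_coefE lead_coef_eq0 -size_poly_eq0 sP.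
have frac i : (i < 3)%N ->
    exists a b, [/\ a \in S, b \in S, b != 0 & P`_i = a / b].
  by rewrite -sP => /(all_nthP 0 PK); rewrite inE.
have [a0 [b0 [a0S b0S b00 E0]]] := frac 0%N isT.
have [a1 [b1 [a1S b1S b10 E1]]] := frac 1%N isT.
have [a2 [b2 [a2S b2S b20 E2]]] := frac 2%N isT.
(* The equation is multiplied by the common denominator [b0 * b1 * b2]. *)
exists (a2 * (b0 * b1), a1 * (b0 * b2), a0 * (b1 * b2)); split => /=.
- by split; do ?apply: subring_mul.
- rewrite !mulf_neq0 //; apply: contraNneq P2 => a20.
  by rewrite E2 a20 mul0r.
- rewrite /surd_eval /= -[RHS](mulr0 (b0 * b1 * b2)) -Pz E0 E1 E2; field.
  by rewrite b00 b10 b20.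
Qed.

End Subring.
End QuadraticEquations.

Lemma affine_contraction_bounded (K : numFieldType) (r d : K) (x w : nat -> K) :
  1 < r -> 0 <= d -> (forall n, 0 <= x n) -> (forall n, r <= w n) ->
  (forall n, x n.+1 * w n <= d + x n / w n) ->
  exists M, forall n, x n <= M.
Proof.
move=> r1 d0 x0 rw xS; have r10 : 0 < r - 1 by rewrite subr_gt0.
have r0 : 0 < r := lt_trans ltr01 r1.
have w0 n : 0 < w n := lt_le_trans r0 (rw n).
(* The term [d / (r - 1)] is the fixed point of the map sending [x] to [(d + x) / r]; adding [x 0]
   covers the initial value. *)
exists (x 0%N + d / (r - 1)); elim=> [|n IH].
  by rewrite lerDl divr_ge0 // ltW.
rewrite -(ler_pM2r r0).
have h1 : x n.+1 * r <= x n.+1 * w n by rewrite ler_wpM2l.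
apply: (le_trans h1); apply: (le_trans (xS n)).
have h2 : x n / w n <= x n.
  by rewrite ler_pdivrMr // ler_peMr // (le_trans (ltW r1)).
have h3 : d + x n / w n <= d + (x 0%N + d / (r - 1)).
  by rewrite lerD2l (le_trans h2).
apply: (le_trans h3).
rewrite -subr_ge0 [X in 0 <= X](_ : _ = x 0%N * (r - 1)).
  by rewrite mulr_ge0 // ltW.
by field; rewrite gt_eqF.
Qed.

(** * Finiteness of bounded parts of a discrete subring *)

Section ComplexPlane.
Variable R : realType.

Lemma normc_ge_Im (x : R[i]) : `|complex.Im x|%:C <= `|x|.
Proof.
rewrite normc_def lecR -sqrtr_sqr ler_sqrt ?lerDr ?sqr_ge0 //.
by rewrite addr_ge0 ?sqr_ge0.
Qed.

Lemma trunc_eq_dist (u v : R) : 0 <= u -> 0 <= v ->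
  Num.truncn u = Num.truncn v -> (u - v) ^+ 2 < 1.
Proof.
move=> u0 v0 E; have := truncn_itv u0; have := truncn_itv v0.
rewrite E -!natr1 => /andP[h1 h2] /andP[h3 h4].
have d1 : u - v < 1 by lra.
have d2 : -1 < u - v by lra.
by nra.
Qed.

(* The cells of a grid of mesh e / 2 contain at most one point each. *)
Lemma separated_bounded_finite (A : set R[i]) (e M : R) : 0 < e ->
  (forall x, A x -> `|x| <= M%:C) ->
  (forall x y, A x -> A y -> `|x - y| < e%:C -> x = y) ->
  finite_set A.
Proof.
move=> e0 AM Ae.
(* The shift by [M] makes the coordinates nonnegative, so that truncation is the floor. *)
pose g (u : R) := (u + M) * (2 / e).
pose h (x : R[i]) :=
  (Num.truncn (g (complex.Re x)), Num.truncn (g (complex.Im x))).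
have e2 : 0 < 2 / e by rewrite divr_gt0.
have bnd (u : R) : `|u| <= M -> 0 <= g u <= (M + M) * (2 / e).
  rewrite ler_norml => /andP[h1 h2].
  by rewrite /g mulr_ge0 ?ler_pM2r ?lerD2r ?h2 ?(ltW e2) //; lra.
have AR x : A x -> `|complex.Re x| <= M.
  by move=> /AM /(le_trans (normc_ge_Re x)); rewrite lecR.
have AI x : A x -> `|complex.Im x| <= M.
  by move=> /AM /(le_trans (normc_ge_Im x)); rewrite lecR.
have hinj : {in A &, injective h}.
  move=> x y /set_mem Ax /set_mem Ay [hR hI]; apply: Ae => //.
  have /andP[x1 _] := bnd _ (AR _ Ax); have /andP[x2 _] := bnd _ (AI _ Ax).
  have /andP[y1 _] := bnd _ (AR _ Ay); have /andP[y2 _] := bnd _ (AI _ Ay).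
  have dR := trunc_eq_dist x1 y1 hR; have dI := trunc_eq_dist x2 y2 hI.
  rewrite normc_def ltcR -[e](gtr0_norm e0) -sqrtr_sqr ltr_sqrt ?exprn_gt0 //.
  rewrite !raddfB /=; move: dR dI; rewrite /g.
  set a := complex.Re x; set b := complex.Re y.
  set c := complex.Im x; set d := complex.Im y.
  (* In a common cell each coordinate difference has square below [e ^+ 2 / 4], so the squared
     distance is below [e ^+ 2]. *)
  have sc u v : ((u + M) * (2 / e) - (v + M) * (2 / e)) ^+ 2 =
    4 * (u - v) ^+ 2 / e ^+ 2 by field; rewrite gt_eqF.
  rewrite !sc !ltr_pdivrMr ?exprn_gt0 // !mul1r => dR dI.
  by have : 0 < e ^+ 2 := exprn_gt0 2 e0; nra.
rewrite -(eq_finite_set (inj_card_eq hinj)).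
pose N := (Num.truncn ((M + M) * (2 / e))).+1.
apply: (@sub_finite_set _ _ (`I_N `*` `I_N)); last exact: finite_setX.
move=> _ [x Ax <-]; split => /=; rewrite ltnS le_truncn //.
  by have /andP[] := bnd _ (AR _ Ax).
by have /andP[] := bnd _ (AI _ Ax).
Qed.

(** Isolation of 0 alone gives a uniform separation, because differences stay in the subring. *)
Lemma discrete_subring_ball_finite (G : {pred R[i]}) (M : R[i]) :
  subring_closed G -> discrete_subset G ->
  finite_set [set x | x \in G /\ `|x| <= M].
Proof.
move=> Gr Gd.
have [_ [V /nbhs_ballP[e /= e0 eV] VG]] := Gd 0 (subring0 Gr).
(* The radius is a complex number; being positive, it is real. *)
have eE : e = (complex.Re e)%:C.
  by move: e0; rewrite ltcE /= => /andP[/eqP Ie _]; case: e Ie {eV} => ? ? /= ->.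
apply: (@separated_bounded_finite _ (complex.Re e) (complex.Re M)).
- by move: e0; rewrite eE ltcR.
- move=> x [_ xM].
  have : 0 <= M := le_trans (normr_ge0 x) xM.
  move: xM; case: M => u v; rewrite [0 <= _]lecE /= => xM /andP[/eqP v0 _].
  by rewrite v0 in xM.
move=> x y [xG _] [yG _] xy; apply/eqP; rewrite -subr_eq0; apply/eqP.
suff : (V `&` [set` G]) (x - y) by rewrite VG.
split; last exact: subring_sub.
by apply: eV; rewrite -ball_normE /= sub0r normrN eE.
Qed.

End ComplexPlane.

(** Pigeonhole: some value recurs at indices [i < j], and the recursion propagates the period
    [j - i] from [i] on. *)
Lemma finite_orbit_eventually_periodic (T : Type) (g : T -> T) (x : nat -> T) :
  (forall n, x n.+1 = g (x n)) -> finite_set (range x) ->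
  eventually_periodic x.
Proof.
move=> xS /finite_range_cst_subsequence[y [A Ainf Ay]].
have [i Ai] := infinite_setN0 Ainf.
have [j [Aj ij]] : exists j, A j /\ (i < j)%N.
  apply: contrapT => nj; apply: Ainf.
  apply: (@sub_finite_set _ _ `I_i.+1) => // j Aj /=.
  by rewrite ltnS leqNgt; apply/negP => ij; apply: nj; exists j.
exists i, (j - i)%N; split; first by rewrite subn_gt0.
move=> n /subnK <-; elim: (n - i)%N => [|k IH].
  by rewrite !add0n subnKC 1?ltnW // (iffLR (Ay j)) // (iffLR (Ay i)).
by rewrite !addSn !xS IH.
Qed.

Theorem theorem4p2 (R : realType) (Gamma : {pred R[i]})
    (Gamma_subring : subring_closed Gamma)
    (Gamma_discrete : discrete_subset Gamma)
    (z : R[i]) (z_surd : quadratic_surd (quotient_field Gamma) z)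
    (z_ : nat -> R[i])
    (z_neq0 : forall n, z_ n != 0)
    (z_0 : z_ 0%N = z)
    (z_ge1 : forall n, (1 <= n)%N -> 1 <= `|z_ n|)
    (z_neqV : forall n, z_ n.+1 != (z_ n)^-1)
    (a : nat -> R[i])
    (aE : forall n, a n = z_ n - (z_ n.+1)^-1)
    (a_Gamma : forall n, a n \in Gamma)
    (p q : nat -> R[i]) (pE : p = Qpair_p a) (qE : q = Qpair_q a)
    (z_gt : exists2 alpha : R, 0 < alpha &
      forall n, (1 <= n)%N -> (1 + alpha)%:C < `|z_ n|)
    (q_oo : `|q n| @[n --> \oo] --> +oo) :
  finite_set [set z_ n | n in [set: nat]] /\
  forall f : R[i] -> R[i],
    (forall w, f w \in Gamma) ->
    (forall w, `|w - f w| <= 1) ->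
    (forall n, z_ n.+1 = (z_ n - f (z_ n))^-1) ->
    eventually_periodic a.
Proof.
have zfin : finite_set (range z_); last first.
  split=> // f _ _ zS.
  have [N [k [k0 zper]]] :=
    @finite_orbit_eventually_periodic _ (fun w => (w - f w)^-1) _ zS zfin.
  exists N, k; split=> // n Nn; rewrite !aE -addSn !zper //.
  exact: leqW.
have [t [tG t0 tz]] := quadratic_surd_coefs Gamma_subring z_surd.
have zK n : z_ n \notin quotient_field Gamma.
  elim: n => [|n]; first by rewrite z_0; case: z_surd.
  apply: contra => zK; rewrite -[z_ n](subrK (z_ n.+1)^-1) -aE.
  exact: quotient_field_addV.
pose T := surd_coefs t a.
have TG n : coefs_in Gamma (T n) by exact: surd_coefs_in.
have Tz n : surd_eval (T n) (z_ n) = 0.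
  elim: n => [|n IH]; first by rewrite z_0.
  by rewrite /T surd_coefsS aE surd_step_root.
pose d := surd_deriv t z.
have TdS n : surd_deriv (T n.+1) (z_ n.+1) = - surd_deriv (T n) (z_ n).
  by rewrite /T surd_coefsS aE surd_step_deriv // Tz.
have Td n : surd_deriv (T n) (z_ n) = d \/ surd_deriv (T n) (z_ n) = - d.
  elim: n => [|n [] IH]; first by left; rewrite z_0.
    by right; rewrite TdS IH.
  by left; rewrite TdS IH opprK.
have Tdn n : `|surd_deriv (T n) (z_ n)| = `|d|.
  by have [-> | ->] := Td n; rewrite ?normrN.
have two0 : 2 != 0 :> R[i] by rewrite pnatr_eq0.
have G1 := subring1 Gamma_subring.
have G2 : 2 \in Gamma by rewrite -[2]/(1 + 1) subring_add.
(* Otherwise [z] would be the double root [- B / (2 * A)], which lies in the quotient field. *)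
have d0 : d != 0.
  have [zK0 _] := z_surd; apply: contraNneq zK0.
  rewrite /d /surd_deriv; case: (t) tG t0 => [[A B] C] [/= AG BG CG] A0 dE.
  have A20 : 2 * A != 0 by rewrite mulf_neq0.
  have -> : z = (- B) / (2 * A).
    by apply: (mulIf A20); rewrite divfK // mulrC -[LHS]subr0 -dE; ring.
  by rewrite mem_quotient_field ?subring_opp ?subring_mul.
(* If it vanished, the equation would be linear with slope [d] or [- d], placing [z_ n] in the
   quotient field. *)
have A0 n : (T n).1.1 != 0.
  apply: contraTneq (zK n) => A0; rewrite negbK.
  have := Tdn n; have := Tz n; have [_ BG CG] := TG n.
  rewrite /surd_eval /surd_deriv A0 mul0r mulr0 mul0r !add0r => zE Bd.
  have B0 : (T n).1.2 != 0 by rewrite -normr_eq0 Bd normr_eq0.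
  have -> : z_ n = - (T n).2 / (T n).1.2.
    by apply: (mulIf B0); rewrite divfK // mulrC -[LHS]subr0 -zE; ring.
  by rewrite mem_quotient_field ?subring_opp.
have [alpha alpha0 z_alpha] := z_gt.
have [M AM] : exists M, forall n, `|(T n).1.1| <= M.
  apply: (@affine_contraction_bounded _ (1 + alpha)%:C `|d| _
    (fun n => `|z_ n.+1|)) => //.
  - by rewrite ltcR ltrDl.
  - by move=> n; rewrite ltW // z_alpha.
  - move=> n; rewrite -normrM /T surd_coefsS aE surd_step_lead ?Tz //.
    by rewrite (le_trans (ler_normD _ _)) // normrN Tdn normf_div.
have M0 : 0 <= M := le_trans (normr_ge0 _) (AM 0%N).
(* The index starts at 1, where the constant coefficient is the previous leading one. The final
   [+ 1] comes from [b <= b ^+ 2 + 1], which replaces a square root. *)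
have BM n : `|(T n.+1).1.2| <= `|d| ^+ 2 + 4 * M * M + 1.
  set b := `|_|.
  have b0 : 0 <= b := normr_ge0 _.
  have bb : b ^+ 2 <= `|d| ^+ 2 + 4 * M * M.
    rewrite -normrX (surd_discr (Tz n.+1)) (le_trans (ler_normD _ _)) //.
    rewrite normrX Tdn lerD2l !normrM (ger0_norm (ler0n _ 4)).
    have -> : (T n.+1).2 = (T n).1.1.
      by rewrite /T surd_coefsS; case: (surd_coefs _ _ _) => [[]].
    by rewrite ler_pM ?mulr_ge0 // ler_wpM2l.
  have b_le : b <= b ^+ 2 + 1.
    have [b1|b1] := real_leP (ger0_real b0) (@real1 _).
      by rewrite (le_trans b1) // lerDr exprn_ge0.
    by apply: (le_trans (@ler_eXnr _ _ 2 isT (ltW b1))); rewrite lerDl.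
  by rewrite (le_trans b_le) // lerD2r.
set M' := `|d| ^+ 2 + 4 * M * M + 1 in BM.
have Afin := discrete_subring_ball_finite M Gamma_subring Gamma_discrete.
have Bfin := discrete_subring_ball_finite M' Gamma_subring Gamma_discrete.
have Dfin : finite_set [set d; - d] by [].
pose root (u : R[i] * R[i] * R[i]) := (u.2 - u.1.2) / (2 * u.1.1).
have rfin := finite_image root (finite_setX (finite_setX Afin Bfin) Dfin).
(* The value at index 0 is added separately, since [BM] starts at index 1. *)
have := conj (finite_set1 z) rfin; rewrite -finite_setU.
apply: sub_finite_set => _ [[|n] _ <-]; first by left; rewrite z_0.
right; have [AG BG _] := TG n.+1.
exists ((T n.+1).1.1, (T n.+1).1.2, surd_deriv (T n.+1) (z_ n.+1)).
  split; last exact: Td.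
  by split; [exact: (conj AG (AM n.+1)) | exact: (conj BG (BM n))].
have := A0 n.+1; move: (T n.+1) => u u0.
rewrite /root /surd_deriv /= addrK mulrC mulKf //.
by rewrite mulf_neq0.
Qed.
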